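(* There exist uniformly discrete dense forests in $\mathbb{R}^2$ which are a finite union of cut-and-project sets.
   Context: A set $Y\subset\mathbb{R}^n$ is uniformly discrete if there is a uniform positive lower bound on the distance between two distinct points of $Y$. It is a dense forest if there is a function $v:(0,\infty)\to(0,\infty)$ such that for every $\varepsilon>0$, every line segment of length $v(\varepsilon)$ comes within distance $\varepsilon$ of $Y$. Cut-and-project sets: let $n,k\ge1$, $N=n+k$, $\mathbb{R}^N=V_{phys}\oplus V_{int}$ with $\dim V_{phys}=n$, $\dim V_{int}=k$, with associated projections $\pi_{phys},\pi_{int}$; for a translated lattice $L\subset\mathbb{R}^N$ and a bounded set $W\subset V_{int}$, the set $\pi_{phys}(L\cap\pi_{int}^{-1}(W))\subset V_{phys}\cong\mathbb{R}^n$ is a cut-and-project set. *)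

(* Defs.v *)
From HB Require Import structures.
From mathcomp Require Import all_boot all_order all_algebra.
From mathcomp Require Import all_classical all_reals all_analysis.

Set Implicit Arguments.
Unset Strict Implicit.
Unset Printing Implicit Defensive.

Import Order.TTheory GRing.Theory Num.Theory.
Import numFieldNormedType.Exports.

Local Open Scope classical_set_scope.
Local Open Scope ring_scope.

(* The norm that the library puts on row vectors is the sup norm, hence the
   separate Euclidean distance. *)
Definition enorm (R : realType) (n : nat) (x : 'rV[R]_n) : R :=
  Num.sqrt (\sum_(i < n) (x 0 i) ^+ 2).

Definition edist (R : realType) (n : nat) (x y : 'rV[R]_n) : R :=
  enorm (x - y).

Definition uniformly_discrete (R : realType) (n : nat) (Y : set 'rV[R]_n)
    : Prop :=
  exists2 r : R, 0 < r &
    forall x y, Y x -> Y y -> x <> y -> r <= edist x y.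

Definition segment (R : realType) (n : nat) (a b : 'rV[R]_n)
    : set 'rV[R]_n :=
  [set a + t *: (b - a) | t in `[0, 1]].

Definition dense_forest (R : realType) (n : nat) (Y : set 'rV[R]_n) : Prop :=
  exists2 v : R -> R, (forall eps, 0 < eps -> 0 < v eps) &
    forall eps, 0 < eps ->
    forall a b : 'rV[R]_n, edist a b = v eps ->
    exists2 p, segment a b p & exists2 y, Y y & edist p y <= eps.

Definition lattice (R : realType) (N : nat) (L : set 'rV[R]_N) : Prop :=
  exists2 B : 'M[R]_N, B \in unitmx &
    L = [set \sum_(i < N) (z 0 i)%:~R *: row i B | z in [set: 'rV[int]_N]].

Definition translated_lattice (R : realType) (N : nat) (L : set 'rV[R]_N)
    : Prop :=
  exists (t : 'rV[R]_N) (L0 : set 'rV[R]_N),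
    lattice L0 /\ L = [set t + x | x in L0].

(* [daddv_pi U V] is the projection onto U along V; [phi] is the
   identification of Vphys with R^n. *)
Definition cut_and_project (R : realType) (n : nat) (Y : set 'rV[R]_n)
    : Prop :=
  (1 <= n)%N /\
  exists (k : nat) (Vphys Vint : {vspace 'rV[R]_(n + k)})
    (phi : {linear subvs_of Vphys -> 'rV[R]_n})
    (L W : set 'rV[R]_(n + k)),
    [/\ (1 <= k)%N,
        [/\ \dim Vphys = n, \dim Vint = k, directv (Vphys + Vint)
          & (Vphys + Vint)%VS = fullv],
        bijective phi,
        translated_lattice L
      & [/\ W `<=` [set w | w \in Vint], bounded_set W
          & Y = [set phi (vsproj Vphys (daddv_pi Vphys Vint x))
                | x in L `&` (daddv_pi Vint Vphys) @^-1` W]]].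

Definition finite_union_of_cut_and_project (R : realType) (n : nat)
    (Y : set 'rV[R]_n) : Prop :=
  exists (m : nat) (F : 'I_m -> set 'rV[R]_n),
    (forall i, cut_and_project (F i)) /\ Y = \bigcup_i F i.

(* Main.v *)
Require Import Defs.
From mathcomp Require Import all_boot all_order all_algebra.
From mathcomp Require Import all_classical all_reals all_analysis.
From mathcomp Require Import ring lra zify.

(* Take three grids in the plane, cut out by the conditions
     x in Z,        y in Z;
     y in Z + 1/2,  sqrt 2 x + sqrt 3 y in Z;
     x in Z + 1/2,  sqrt 2 x + sqrt 3 y in Z + 1/2.
   Any two of them share a linear functional whose values on the two grids
   differ by at least 1/2, so their union is uniformly discrete. A long segment
   stays away from a grid only if its direction nearly satisfies an integer
   relation with bounded coefficients between the two functionals of the grid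
   (Kronecker). Since 1, sqrt 2, sqrt 3 are linearly independent over the
   rationals, no direction satisfies such relations for all three grids at
   once, and boundedness of the coefficients makes this uniform in the
   direction. *)

Set Implicit Arguments.
Unset Strict Implicit.
Unset Printing Implicit Defensive.

Import Order.TTheory GRing.Theory Num.Theory.

Local Open Scope classical_set_scope.
Local Open Scope ring_scope.

(** * Translated lattices and grids as cut-and-project sets *)

Section LatticesAreCutAndProject.
Variable R : realType.

Lemma integer_span_rowsE (N : nat) (B : 'M[R]_N) :
  [set \sum_(i < N) (z 0 i)%:~R *: row i B | z in [set: 'rV[int]_N]] =
  [set map_mx intr z *m B | z in [set: 'rV[int]_N]].
Proof.
apply: eq_imagel => z _.
by rewrite mulmx_sum_row; apply: eq_bigr => i _; rewrite mxE.
Qed.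

Lemma lattice_mulmx (N : nat) (B : 'M[R]_N) : B \in unitmx ->
  lattice [set map_mx intr z *m B | z in [set: 'rV[int]_N]].
Proof. by move=> uB; exists B; rewrite ?integer_span_rowsE. Qed.

(** The two projections add up to [x], and membership in [U] and [V] kills one block of each, so the
    abstract projections are just the two blocks of [x]. *)
Lemma daddv_piE (n k : nat) (U V : {vspace 'rV[R]_(n + k)}) x :
  (forall y, (y \in U) = (rsubmx y == 0)) ->
  (forall y, (y \in V) = (lsubmx y == 0)) ->
  (U :&: V = 0)%VS -> (U + V)%VS = fullv ->
  daddv_pi U V x = row_mx (lsubmx x) 0 /\ daddv_pi V U x = row_mx 0 (rsubmx x).
Proof.
move=> hU hV dUV fUV.
have e : daddv_pi U V x + daddv_pi V U x = x.
  by rewrite daddv_pi_add // fUV memvf.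
move: (memv_pi U V x) (memv_pi V U x).
rewrite hU hV => /eqP rU /eqP lV.
split; [rewrite -[LHS]hsubmxK | rewrite -[LHS]hsubmxK].
  by rewrite rU -{2}e linearD /= lV addr0.
by rewrite lV -{2}e linearD /= rU add0r.
Qed.

(** Rank-nullity, with surjectivity certified by a right inverse [g] that need not be linear. *)
Lemma dim_lker_linfun_surj (aT rT : vectType R) (f : {linear aT -> rT})
    (g : rT -> aT) : cancel g f -> (\dim (lker (linfun f)) + dim rT = dim aT)%N.
Proof.
move=> gK; rewrite -!dimvf -(limg_ker_dim (linfun f) fullv) capfv.
congr (_ + \dim _)%N; apply/esym/vspaceP => y; rewrite memvf.
by apply/memv_imgP; exists (g y); rewrite ?memvf // lfunE /= gK.
Qed.

(* Add one internal dimension, spanned by an extra lattice vector, and take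
   the window {0}. *)
Lemma translated_lattice_cut_and_project (n : nat) (Y : set 'rV[R]_n) :
  (1 <= n)%N -> translated_lattice Y -> cut_and_project Y.
Proof.
move=> n1 [t [_ [[B uB ->] ->]]]; rewrite integer_span_rowsE; split => //.
pose rs : {linear 'rV[R]_(n + 1) -> 'rV[R]_1} := rsubmx.
pose ls : {linear 'rV[R]_(n + 1) -> 'rV[R]_n} := lsubmx.
pose U := lker (linfun rs); pose V := lker (linfun ls).
have hU y : (y \in U) = (rsubmx y == 0) by rewrite memv_ker lfunE.
have hV y : (y \in V) = (lsubmx y == 0) by rewrite memv_ker lfunE.
have dU : \dim U = n.
  have := dim_lker_linfun_surj (f := rs) (g := row_mx 0) (fun y => row_mxKr _ y).
  rewrite !dim_matrix !mul1r -/U => /eqP; by rewrite eqn_add2r => /eqP.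
have dV : \dim V = 1%N.
  have := dim_lker_linfun_surj (f := ls) (g := row_mx ^~ 0)
    (fun y => row_mxKl y _).
  rewrite !dim_matrix !mul1r -/V addnC => /eqP; by rewrite eqn_add2l => /eqP.
have dUV : (U :&: V = 0)%VS.
  apply/eqP; rewrite -subv0; apply/subvP => y; rewrite memv_cap hU hV memv0.
  by case/andP=> /eqP r0 /eqP l0; rewrite -[y]hsubmxK r0 l0 row_mx0.
have fUV : (U + V)%VS = fullv.
  apply/eqP; rewrite eqEdim subvf /= dimv_disjoint_sum //.
  by rewrite dU dV dimvf dim_matrix mul1r.
pose phi : {linear subvs_of U -> 'rV[R]_n} := ls \o vsval.
have piE x := @daddv_piE n 1 U V x hU hV dUV fUV.
pose C : 'M[R]_(n + 1) := block_mx B 0 0 1%:M.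
exists 1%N, U, V, phi,
  [set row_mx t 0 + x | x in [set map_mx intr z *m C | z in setT]],
  [set 0].
have Cz (z : 'rV[int]_(n + 1)) : map_mx intr z *m C =
    row_mx (map_mx intr (lsubmx z) *m B) (map_mx intr (rsubmx z)).
  rewrite -{1}[z]hsubmxK map_row_mx mul_row_block !mulmx0 mulmx1.
  by rewrite addr0 add0r.
split => //.
- by split=> //; apply/directv_addP.
- exists (fun x => vsproj U (row_mx x 0)) => x.
    apply/val_inj; rewrite /= vsprojK ?hU ?row_mxKr //.
    by have := subvsP x; rewrite hU => /eqP <-; rewrite hsubmxK.
  by rewrite /phi /= vsprojK ?row_mxKl // hU row_mxKr.
- exists (row_mx t 0), [set map_mx intr z *m C | z in setT]; split => //.
  by apply: lattice_mulmx; rewrite unitmxE det_ublock det1 mulr1 -unitmxE.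
- split.
  + by move=> w ->; rewrite /= mem0v.
  + by exists 0; split => // M M0 w /= ->; rewrite normr0 ltW.
apply/seteqP; split => [_ [_ [z _ <-] <-]|_ [x [[_ [z _ <-] <-] /= zW] <-]].
- pose z' : 'rV[int]_(n + 1) := row_mx z 0.
  exists (row_mx t 0 + map_mx intr z' *m C); last first.
    rewrite (piE _).1 /= vsprojK ?hU ?row_mxKr // row_mxKl Cz linearD /=.
    by rewrite !row_mxKl.
  split; first by exists (map_mx intr z' *m C) => //; exists z'.
  rewrite /preimage /= (piE _).2 Cz linearD /= !row_mxKr map_mx0 addr0.
  by rewrite row_mx0.
- exists (map_mx intr (lsubmx z) *m B); first by exists (lsubmx z).
  rewrite (piE _).1 /= vsprojK ?hU ?row_mxKr // row_mxKl Cz linearD /=.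
  by rewrite !row_mxKl.
Qed.

(** Multiplying by [invmx A] turns the condition into membership in the lattice spanned by the rows
    of [invmx A], shifted by [s *m invmx A]. *)
Lemma grid_translated_lattice (N : nat) (A : 'M[R]_N) (s : 'rV[R]_N) :
  A \in unitmx ->
  translated_lattice [set x | exists z : 'rV[int]_N, x *m A = s + map_mx intr z].
Proof.
move=> uA; exists (s *m invmx A), [set map_mx intr z *m invmx A | z in setT].
split; first by apply: lattice_mulmx; rewrite unitmx_inv.
apply/seteqP; split => [x [z xz]|_ [_ [z _ <-] <-]].
  exists (map_mx intr z *m invmx A); first by exists z.
  by rewrite -mulmxDl -xz mulmxK.
by exists z; rewrite -mulmxDl mulmxKV.
Qed.

Definition grid2 (a b c d s t : R) : set 'rV[R]_2 :=
  [set x | exists k l : int, a * x 0 0 + b * x 0 1 = s + k%:~R /\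
                             c * x 0 0 + d * x 0 1 = t + l%:~R].

Lemma sum_ord2 (F : 'I_2 -> R) : \sum_(i < 2) F i = F 0 + F 1.
Proof.
rewrite big_ord_recl big_ord1; congr (_ + F _); exact: val_inj.
Qed.

Lemma row2P (T : Type) (x y : 'rV[T]_2) : x 0 0 = y 0 0 -> x 0 1 = y 0 1 -> x = y.
Proof.
move=> e0 e1; apply/rowP => i; have [->|->] : i = 0 \/ i = 1 => //.
case: i => -[|[|//]] lti; [left|right]; exact: val_inj.
Qed.

Definition row2 (T : Type) (u v : T) : 'rV[T]_2 :=
  \row_i if i == 0 then u else v.

Lemma cut_and_project_grid2 (a b c d s t : R) :
  a * d - b * c != 0 -> cut_and_project (grid2 a b c d s t).
Proof.
move=> D0; apply: translated_lattice_cut_and_project => //.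
(* The columns of [A] are the two functionals, so [x *m A] lists their values at [x]. *)
pose A : 'M[R]_2 := \matrix_(i, j) if j == 0 then row2 a b 0 i else row2 c d 0 i.
have uA : A \in unitmx.
  rewrite unitmxE unitfE (expand_det_row _ 0) sum_ord2 /cofactor !det_mx11.
  rewrite !mxE /=. move: D0; congr (_ != 0); rewrite expr0 (expr1 (-1)); ring.
rewrite (_ : grid2 _ _ _ _ _ _ =
  [set x | exists z : 'rV[int]_2, x *m A = row2 s t + map_mx intr z]).
  exact: grid_translated_lattice.
have AE (x : 'rV_2) : (x *m A) 0 0 = a * x 0 0 + b * x 0 1 /\
            (x *m A) 0 1 = c * x 0 0 + d * x 0 1.
  by rewrite !mxE !sum_ord2 !mxE /=; split; ring.
apply/seteqP; split => [x [k [l [e1 e2]]]|x [z e]].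
  exists (row2 k l); apply: row2P.
    by rewrite (AE x).1 e1 !mxE.
  by rewrite (AE x).2 e2 !mxE.
exists (z 0 0), (z 0 1); rewrite -(AE x).1 -(AE x).2 e.
by rewrite !mxE.
Qed.
End LatticesAreCutAndProject.

(** * Quantitative Kronecker approximation for linear flows *)

Section Kronecker.
Variable R : realType.

(** Pigeonhole: the fractional parts of [i * x] for the [Q + 2] indices [i <= Q + 1] fall into
    [Q + 1] boxes of length [1 / (Q + 1)]; [q] is the difference of two indices sharing a box. *)
Lemma dirichlet_approximation (x : R) (Q : nat) :
  exists (q : nat) (p : int),
    [/\ (0 < q <= Q.+1)%N & `|q%:R * x - p%:~R| <= Q.+1%:R^-1].
Proof.
pose fr (i : nat) : R := i%:R * x - (Num.floor (i%:R * x))%:~R.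
have fr0 i : 0 <= fr i by rewrite subr_ge0 floor_le.
have fr1 i : fr i < 1.
  by have := floorD1_gt (i%:R * x); rewrite /fr intrD; lra.
have Q0 : 0 < Q.+1%:R :> R by rewrite ltr0n.
have box_lt (i : nat) : (Num.truncn (Q.+1%:R * fr i) < Q.+1)%N.
  by rewrite truncn_lt_nat ?mulr_ge0 // gtr_pMr.
pose box (i : 'I_Q.+2) : 'I_Q.+1 := Ordinal (box_lt i).
have /injectivePn[i [j neq_ij eq_ij]] : ~~ injectiveb box.
  apply/negP => /injectiveP/leq_card.
  by rewrite !card_ord ltnn.
wlog lt_ij : i j neq_ij eq_ij / (i < j)%N.
  move=> H; case: (ltngtP i j) => h; first exact: (H i j).
    by apply: (H j i) => //; rewrite eq_sym.
  by move: neq_ij; rewrite (val_inj h) eqxx.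
exists (j - i)%N, (Num.floor (j%:R * x) - Num.floor (i%:R * x)); split.
  by have := ltn_ord j; lia.
rewrite (_ : _ - _ = fr j - fr i); last first.
  by rewrite natrB 1?ltnW // intrB /fr; ring.
have /(congr1 val)/= e := eq_ij.
have h k := truncn_itv (mulr_ge0 (ltW Q0) (fr0 k)).
have := h i; have := h j; rewrite e -[(Num.truncn _).+1%:R]natr1.
move: Q0; set m : R := Q.+1%:R; set n : R := _%:R.
move=> m0 /andP[a1 a2] /andP[b1 b2].
rewrite -[_^-1]mul1r ler_pdivlMr // -{1}(gtr0_norm m0) -normrM.
rewrite ler_norml; apply/andP; split; lra.
Qed.

(** A walk with steps no longer than [d] cannot jump over the [d]-neighbourhood of an integer, and
    the next integer ahead is at distance at most 1. *)
Lemma small_steps_meet_integers (s d z : R) : s != 0 -> `|s| <= d ->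
  exists (j : nat) (k : int), j%:R <= `|s|^-1 /\ `|z + j%:R * s - k%:~R| <= d.
Proof.
wlog s0 : s z / 0 < s => [H sN0 sd|_].
  have [s0|s0|s0] := ltgtP 0 s; first exact: H.
    have [||| j [k [jle jk]]] := H (- s) (- z).
    - by rewrite oppr_gt0.
    - by rewrite oppr_eq0.
    - by rewrite normrN.
    exists j, (- k); rewrite -[`|s|]normrN; split => //.
    by rewrite -normrN intrN; move: jk; congr (`|_| <= _); ring.
  by rewrite -s0 eqxx in sN0.
rewrite gtr0_norm // => sd.
pose k := Num.floor z + 1.
have zk : z < k%:~R by exact: floorD1_gt.
have kz : k%:~R <= z + 1 by rewrite intrD lerD2r floor_le.
pose w := (k%:~R - z) / s.
have w0 : 0 <= w by rewrite divr_ge0 ?ltW // subr_gt0.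
have /andP[t1 t2] := truncn_itv w0.
(* Truncation selects the last position not beyond [k], which leaves a gap below [s]. *)
exists (Num.truncn w), k; split.
  apply: (le_trans t1); rewrite /w -[leRHS]mul1r ler_wpM2r ?invr_ge0 ?(ltW s0) //.
  by rewrite lerBlDl.
move: t1 t2; rewrite /w ler_pdivlMr // ltr_pdivrMr // -natr1.
set n : R := _%:R => t1 t2; rewrite ler_norml; apply/andP; split; lra.
Qed.

(** Dirichlet provides a step [q * x - p] of size at most [d]; being at least [c], it reaches an
    integer within [1 / c] repetitions, each worth [q] multiples of [x]. As [p] is close to [q * x],
    only finitely many pairs [(q, p)] have to be controlled. *)
Lemma inhomogeneous_approximation (x c d z : R) (Q : nat) :
  0 < c -> Q.+1%:R^-1 <= d ->
  (forall (q : nat) (p : int), (0 < q <= Q.+1)%N ->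
     `|p%:~R| <= Q.+1%:R * `|x| + 1 -> c <= `|q%:R * x - p%:~R|) ->
  exists (j : nat) (k : int),
    j%:R <= Q.+1%:R / c /\ `|z + j%:R * x - k%:~R| <= d.
Proof.
move=> c0 Qd hx; have [q [p [qQ hq]]] := dirichlet_approximation x Q.
have Q1 : Q.+1%:R^-1 <= 1 :> R by rewrite invf_le1 ?ler1n ?ltr0n.
have qQR : q%:R <= Q.+1%:R :> R by rewrite ler_nat; case/andP: qQ.
have ple : `|p%:~R| <= Q.+1%:R * `|x| + 1 :> R.
  have -> : p%:~R = q%:R * x - (q%:R * x - p%:~R) by ring.
  apply: (le_trans (ler_normB _ _)); apply: lerD; last exact: le_trans Q1.
  by rewrite normrM ger0_norm // ler_wpM2r.
have cs := hx q p qQ ple.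
set s := q%:R * x - p%:~R in hq cs.
have s0 : s != 0 by rewrite -normr_gt0 (lt_le_trans c0).
have [j [k [jle jk]]] := small_steps_meet_integers z s0 (le_trans hq Qd).
exists (j * q)%N, (k + j%:Z * p); split.
  rewrite natrM mulrC ler_pM //; apply: (le_trans jle).
  by rewrite lef_pV2 ?posrE // (lt_le_trans c0).
move: jk; congr (`|_| <= _); rewrite /s intrD intrM natrM -pmulrn; ring.
Qed.

(** A quantitative rational independence of [v1] and [v2], cut off at height [M]: with finitely many
    relations to avoid, one [h] can serve all directions. *)
Definition no_small_relation (M : nat) (h v1 v2 : R) :=
  forall m n : int, (m, n) != (0, 0) ->
    `|m%:~R| <= M%:R :> R -> `|n%:~R| <= M%:R :> R ->
    h <= `|m%:~R * v1 + n%:~R * v2|.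

(* Follow the flow through its return times to the circle
   {first coordinate integral}. *)
Lemma flow_meets_integers (C h d v1 v2 y1 y2 : R) (Q : nat) :
  0 < h -> Q.+1%:R^-1 <= d -> `|v1| <= C -> `|v2| <= C ->
  no_small_relation Q.+2 h v1 v2 ->
  exists (s : R) (k l : int),
    [/\ 0 <= s <= (1 + Q.+1%:R * C / h) / h,
        `|y1 + s * v1 - k%:~R| <= d & `|y2 + s * v2 - l%:~R| <= d].
Proof.
move=> h0 Qd.
(* Swapping coordinates lets the faster one clock the returns, which keeps the slope [x] in
   [[-1, 1]]. *)
wlog v21 : v1 v2 y1 y2 / `|v2| <= `|v1| => [H c1 c2 hv|].
  have [v21|/ltW v12] := leP `|v2| `|v1|; first exact: H.
  have hv' : no_small_relation Q.+2 h v2 v1.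
    by move=> m n mn hm hn; rewrite addrC hv // xpair_eqE /= andbC.
  have [s [k [l [? ? ?]]]] := H v2 v1 y2 y1 v12 c2 c1 hv'.
  by exists s, l, k.
wlog v1_ge0 : v1 y1 v21 / 0 <= v1 => [H c1 c2 hv|].
  case: (leP 0 v1) => [|/ltW] v1s; first exact: H.
  have [||||| s [k [l [hs h1 h2]]]] := H (- v1) (- y1); rewrite ?normrN ?oppr_ge0 //.
    move=> m n mn hm hn; rewrite mulrN -mulNr -intrN hv //.
      by move: mn; rewrite !xpair_eqE /= oppr_eq0.
    by rewrite intrN normrN.
  exists s, (- k), l; split => //; rewrite -normrN intrN; move: h1.
  by congr (`|_| <= _); ring.
move=> c1 c2 hv.
have M1 : 1 <= Q.+2%:R :> R by rewrite ler1n.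
have hv1 : h <= v1.
  have := hv 1 0 isT; rewrite mul1r mul0r addr0 (ger0_norm v1_ge0) normr1 normr0.
  exact.
have v1_gt0 : 0 < v1 by exact: lt_le_trans hv1.
have C0 : 0 < C by rewrite (lt_le_trans v1_gt0) // -(ger0_norm v1_ge0).
pose x := v2 / v1.
have x1 : `|x| <= 1.
  by rewrite normrM normfV (gtr0_norm v1_gt0) ler_pdivrMr // mul1r -(ger0_norm v1_ge0).
pose k0 := Num.ceil y1; pose s0 := (k0%:~R - y1) / v1.
have s0_ge0 : 0 <= s0 by rewrite divr_ge0 // subr_ge0 ceil_ge.
have s0_le : s0 <= v1^-1.
  rewrite -[leRHS]mul1r ler_wpM2r ?invr_ge0 //.
  by have := ceilB1_lt y1; rewrite -/k0 intrB; lra.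
(* Relations are divided by [v1], hence the constant [h / v1]. Since [|x| <= 1], the coefficient [p]
   is at most [Q.+1 + 1], whence the height [Q.+2]. *)
have hc : 0 < h / v1 by rewrite divr_gt0.
have [q p qQ pQ|j [l [jle jl]]] :=
    inhomogeneous_approximation (x := x) (y2 + s0 * v2) hc Qd.
  rewrite ler_pdivrMr // -{1}(gtr0_norm v1_gt0) -normrM.
  have -> : (q%:R * x - p%:~R) * v1 = (- p)%:~R * v1 + q%:Z%:~R * v2.
    by rewrite /x intrN -pmulrn; field; rewrite gt_eqF.
  apply: hv; first by case/andP: qQ => q0 _; rewrite xpair_eqE eqz_nat -[q == _]leqn0 leqNgt q0 andbF.
    rewrite intrN normrN (le_trans pQ) // -[leRHS]natr1 lerD2r.
    by rewrite ler_piMr.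
  case/andP: qQ => _ qQ.
  by rewrite -pmulrn ger0_norm // ler_nat ltnW.
exists (s0 + j%:R / v1), (k0 + j%:Z), l; split.
(* The first return comes before [1 / h]; then follow at most [Q.+1 * v1 / h] turns of duration
   [1 / v1 <= 1 / h], where [v1 <= C]. *)
- apply/andP; split; first by rewrite addr_ge0 // divr_ge0.
  rewrite mulrDl mul1r lerD //.
    by rewrite (le_trans s0_le) // lef_pV2.
  rewrite ler_pM // ?invr_ge0 //; last by rewrite lef_pV2.
  apply: (le_trans jle); rewrite invf_div mulrA ler_wpM2r ?invr_ge0 ?(ltW h0) //.
  by rewrite ler_wpM2l // -(ger0_norm v1_ge0).
- rewrite (_ : _ - _ = 0) ?normr0; first by rewrite (le_trans _ Qd) ?invr_ge0.
  by rewrite /s0 intrD -pmulrn; field; rewrite gt_eqF.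
- move: jl; congr (`|_| <= _); rewrite /x; ring.
Qed.

End Kronecker.

(** * Integer relations between the three functionals along a direction *)

Section Directions.
Variable R : realType.

(** For nonzero [q] the [l]-adic valuation would be even on the left and odd on the right. *)
Lemma sqr_eq_odd_logn_mul_sqr (l n : nat) (p q : int) :
  odd (logn l n) -> p ^+ 2 = n%:Z * q ^+ 2 -> q = 0.
Proof.
move=> oln /(congr1 absz); rewrite abszM !abszX /= => e.
apply/eqP; rewrite -absz_eq0 -leqn0 leqNgt; apply/negP => q0.
have n0 : (0 < n)%N by case: n oln {e} => //; rewrite logn0.
have := congr1 (odd \o logn l) e; rewrite /= lognM ?expn_gt0 ?q0 //.
by rewrite !lognX oddD !oddM oln.
Qed.

Local Notation sqrt2 := (Num.sqrt 2 : R).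
Local Notation sqrt3 := (Num.sqrt 3 : R).

(** Squaring twice gives [(p^2 - 2 q^2 - 3 r^2)^2 = 6 (2 q r)^2], so [q r = 0] by parity of the
    2-adic valuation; what remains is [p^2 = 3 r^2] or [p^2 = 2 q^2]. *)
Lemma sqrt2_sqrt3_independent (p q r : int) :
  p%:~R + q%:~R * sqrt2 + r%:~R * sqrt3 = 0 -> [/\ p = 0, q = 0 & r = 0].
Proof.
have s2 : sqrt2 ^+ 2 = 2 by rewrite sqr_sqrtr.
have s3 : sqrt3 ^+ 2 = 3 by rewrite sqr_sqrtr.
move=> e; have ep : p%:~R = - (q%:~R * sqrt2 + r%:~R * sqrt3) by lra.
have inj (x y : int) : x%:~R = y%:~R :> R -> x = y by move/eqP; rewrite eqr_int => /eqP.
have qr : 2 * (q * r) = 0.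
  apply: (@sqr_eq_odd_logn_mul_sqr 2 6 (p ^+ 2 - 2 * q ^+ 2 - 3 * r ^+ 2)) => //.
  apply: inj; rewrite !(intrM, intrB, intrD, rmorphXn) /= ep.
  by ring: s2 s3.
have /orP[/eqP q0|/eqP r0] : (q == 0) || (r == 0).
  by move/eqP: qr; rewrite !mulf_eq0.
- have r0 : r = 0.
    apply: (@sqr_eq_odd_logn_mul_sqr 3 3 p) => //.
    by apply: inj; rewrite !(intrM, rmorphXn) /= ep q0; ring: s3.
  by split => //; apply: inj; rewrite ep q0 r0 !mulr0z; ring.
- have q0 : q = 0.
    apply: (@sqr_eq_odd_logn_mul_sqr 2 2 p) => //.
    by apply: inj; rewrite !(intrM, rmorphXn) /= ep r0; ring: s2.
  by split => //; apply: inj; rewrite ep q0 r0 !mulr0z; ring.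
Qed.

Lemma bounded_integer_combinations_discrete (a b : R) (K : nat) :
  exists2 e : R, 0 < e & forall p q r : int,
    `|p%:~R| <= K%:R :> R -> `|q%:~R| <= K%:R :> R -> `|r%:~R| <= K%:R :> R ->
    p%:~R + q%:~R * a + r%:~R * b != 0 ->
    e <= `|p%:~R + q%:~R * a + r%:~R * b|.
Proof.
pose I := 'I_(K + K).+1; pose z (i : I) : int := i%:Z - K%:Z.
have zP p : `|p%:~R| <= K%:R :> R -> exists i, z i = p.
  rewrite -intr_norm pmulrn ler_int => pK.
  exists (inord `|p + K%:Z|); rewrite /z inordK; lia.
pose F (t : I * I * I) := (z t.1.1)%:~R + (z t.1.2)%:~R * a + (z t.2)%:~R * b.
(* A minimum over finitely many triples; the default [1] keeps it positive if all values vanish. *)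
exists (\big[Num.min/1]_(t | F t != 0) `|F t|).
  elim/big_ind: _ => // [x y x0 y0|t]; last by rewrite normr_gt0.
  by rewrite lt_min x0.
move=> _ _ _ /zP[i <-] /zP[j <-] /zP[k <-] nz.
exact: (bigmin_le_cond _ (j := (i, j, k))).
Qed.

Lemma not_no_small_relation (M : nat) (h v1 v2 : R) :
  ~ no_small_relation M h v1 v2 -> exists m n : int,
    [/\ (m, n) != (0, 0), `|m%:~R| <= M%:R :> R, `|n%:~R| <= M%:R :> R
      & `|m%:~R * v1 + n%:~R * v2| < h].
Proof.
apply: contra_notP => H m n mn hm hn; rewrite leNgt; apply/negP => lth.
by apply: H; exists m, n.
Qed.

Lemma sqrt2_bounds : 1 <= sqrt2 <= 2.
Proof.
have s2 : sqrt2 ^+ 2 = 2 by rewrite sqr_sqrtr.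
have := sqrtr_ge0 (2 : R); nra.
Qed.

Lemma sqrt3_bounds : 1 <= sqrt3 <= 2.
Proof.
have s3 : sqrt3 ^+ 2 = 3 by rewrite sqr_sqrtr.
have := sqrtr_ge0 (3 : R); nra.
Qed.

Lemma normM_le (x y a b : R) : `|x| <= a -> `|y| <= b -> `|x * y| <= a * b.
Proof. by move=> hx hy; rewrite normrM ler_pM. Qed.

(** If all three pairs had small relations, two of these would form a linear system in [(v1, v2)]
    whose determinant [D] is an integer combination of 1, [sqrt2], [sqrt3]. If nonzero, [D] is
    bounded below, while Cramer's rule makes [D * v1] and [D * v2] small, against
    [1 <= |v1| + |v2|]. *)
Lemma some_pair_has_no_small_relation (M : nat) :
  exists2 h : R, 0 < h & forall v1 v2 : R, 1 <= `|v1| + `|v2| ->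
    let v3 := sqrt2 * v1 + sqrt3 * v2 in
    [\/ no_small_relation M h v1 v2, no_small_relation M h v2 v3
      | no_small_relation M h v1 v3].
Proof.
(* The coefficients of the determinant are products of two relation coefficients, hence the bound
   [M * M]. *)
have [e e0 he] := bounded_integer_combinations_discrete sqrt2 sqrt3 (M * M).
have M0 : 0 <= M%:R :> R by [].
have C0 : 0 < 7 * M%:R + 1 :> R by lra.
(* In both cases below, the Cramer numerators are bounded by [3 M h] and [4 M h] in some order; the
   extra 1 makes their sum [7 M h] strictly less than [e]. *)
pose h := e / (7 * M%:R + 1).
have h0 : 0 < h by rewrite divr_gt0.
have eh : e = 7 * M%:R * h + h by rewrite /h; field; rewrite gt_eqF.
have /andP[s2l s2u] := sqrt2_bounds; have /andP[s3l s3u] := sqrt3_bounds.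
have absMs2 (m : int) : `|m%:~R| <= M%:R :> R -> `|m%:~R * sqrt2| <= 2 * M%:R.
  by move=> hm; rewrite mulrC normM_le // ger0_norm //; lra.
have absMs3 (m : int) : `|m%:~R| <= M%:R :> R -> `|m%:~R * sqrt3| <= 2 * M%:R.
  by move=> hm; rewrite mulrC normM_le // ger0_norm //; lra.
have absMM (m n : int) : `|m%:~R| <= M%:R :> R -> `|n%:~R| <= M%:R :> R ->
    `|(m * n)%:~R| <= (M * M)%:R :> R.
  by move=> hm hn; rewrite intrM natrM normM_le.
have neq0 (p q r : int) : [|| p != 0, q != 0 | r != 0] ->
    p%:~R + q%:~R * sqrt2 + r%:~R * sqrt3 != 0.
  by apply: contraL => /eqP/sqrt2_sqrt3_independent[-> -> ->].
exists h => // v1 v2 v12 v3.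
have cramer D : e <= `|D| -> `|D * v1| + `|D * v2| <= 7 * M%:R * h -> False.
  move=> eD; rewrite !normrM -mulrDr => hD.
  have : e <= `|D| * (`|v1| + `|v2|).
    by rewrite (le_trans eD) // ler_peMr.
  lra.
have [|/not_no_small_relation[m1 [n1 [mn1 hm1 hn1 E1]]]] :=
  pselect (no_small_relation M h v1 v2); first by constructor 1.
have [|/not_no_small_relation[m2 [n2 [mn2 hm2 hn2 E2]]]] :=
  pselect (no_small_relation M h v2 v3); first by constructor 2.
have [|/not_no_small_relation[m3 [n3 [mn3 hm3 hn3 E3]]]] :=
  pselect (no_small_relation M h v1 v3); first by constructor 3.
exfalso.
set r1 := _ + _ in E1; set r2 := _ + _ in E2; set r3 := _ + _ in E3.
(* The first relation is paired with the third if [m1 = 0] (then [n1] is nonzero) and with the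
   second otherwise: each choice leaves a nonzero coefficient in [D]. *)
have [m10|m10] := eqVneq m1 0.
- have n10 : n1 != 0 by move: mn1; rewrite m10 xpair_eqE.
  pose D : R := (- (n1 * m3))%:~R + (- (n1 * n3))%:~R * sqrt2
                + (m1 * n3)%:~R * sqrt3.
  have D0 : D != 0.
    apply: neq0; rewrite !oppr_eq0 !mulf_eq0 (negbTE n10) /=.
    by move: mn3; rewrite xpair_eqE /= negb_and => /orP[->|->]; rewrite ?orbT.
  apply: (cramer D).
    by apply: he => //; rewrite 1?intrN 1?normrN absMM.
  have -> : D * v1 = n3%:~R * sqrt3 * r1 - n1%:~R * r3.
    by rewrite /D /r1 /r3 /v3 !intrN !intrM; ring.
  have -> : D * v2 = m1%:~R * r3 - m3%:~R * r1 - n3%:~R * sqrt2 * r1.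
    by rewrite /D /r1 /r3 /v3 !intrN !intrM; ring.
  have b1 := normM_le (absMs3 _ hn3) (ltW E1).
  have b2 := normM_le hn1 (ltW E3).
  have b3 := normM_le hm1 (ltW E3).
  have b4 := normM_le hm3 (ltW E1).
  have b5 := normM_le (absMs2 _ hn3) (ltW E1).
  have t1 := ler_normB (n3%:~R * sqrt3 * r1) (n1%:~R * r3).
  have t2 := ler_normB (m1%:~R * r3 - m3%:~R * r1) (n3%:~R * sqrt2 * r1).
  have t3 := ler_normB (m1%:~R * r3) (m3%:~R * r1).
  lra.
- pose D : R := (m1 * m2)%:~R + (- (n1 * n2))%:~R * sqrt2
                + (m1 * n2)%:~R * sqrt3.
  have D0 : D != 0.
    apply: neq0; rewrite !oppr_eq0 !mulf_eq0 (negbTE m10) /=.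
    by move: mn2; rewrite xpair_eqE /= negb_and => /orP[->|->]; rewrite ?orbT.
  apply: (cramer D).
    by apply: he => //; rewrite 1?intrN 1?normrN absMM.
  have -> : D * v1 = m2%:~R * r1 + n2%:~R * sqrt3 * r1 - n1%:~R * r2.
    by rewrite /D /r1 /r2 /v3 !intrN !intrM; ring.
  have -> : D * v2 = m1%:~R * r2 - n2%:~R * sqrt2 * r1.
    by rewrite /D /r1 /r2 /v3 !intrN !intrM; ring.
  have b1 := normM_le hm2 (ltW E1).
  have b2 := normM_le (absMs3 _ hn2) (ltW E1).
  have b3 := normM_le hn1 (ltW E2).
  have b4 := normM_le hm1 (ltW E2).
  have b5 := normM_le (absMs2 _ hn2) (ltW E1).
  have t1 := ler_normB (m2%:~R * r1 + n2%:~R * sqrt3 * r1) (n1%:~R * r2).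
  have t2 := ler_normD (m2%:~R * r1) (n2%:~R * sqrt3 * r1).
  have t3 := ler_normB (m1%:~R * r2) (n2%:~R * sqrt2 * r1).
  lra.
Qed.

End Directions.

(* [all_analysis] has another [edist]. *)
Local Notation edist := Defs.edist.

(** * Separation and visibility of the three grids *)

Section ThreeGrids.
Variable R : realType.

Local Notation sqrt2 := (Num.sqrt 2 : R).
Local Notation sqrt3 := (Num.sqrt 3 : R).

Lemma enorm2_sqr (x : 'rV[R]_2) : enorm x ^+ 2 = x 0 0 ^+ 2 + x 0 1 ^+ 2.
Proof. by rewrite /enorm sqr_sqrtr sum_ord2 ?addr_ge0 ?sqr_ge0. Qed.

Lemma enorm_ge0 (n : nat) (x : 'rV[R]_n) : 0 <= enorm x.
Proof. exact: sqrtr_ge0. Qed.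

Lemma norm0_le_enorm (x : 'rV[R]_2) : `|x 0 0| <= enorm x.
Proof.
rewrite -(@ler_pXn2r _ 2) ?nnegrE ?enorm_ge0 // enorm2_sqr real_normK ?num_real //.
by rewrite lerDl sqr_ge0.
Qed.

Lemma norm1_le_enorm (x : 'rV[R]_2) : `|x 0 1| <= enorm x.
Proof.
rewrite -(@ler_pXn2r _ 2) ?nnegrE ?enorm_ge0 // enorm2_sqr real_normK ?num_real //.
by rewrite lerDr sqr_ge0.
Qed.

Lemma enorm2_le (x : 'rV[R]_2) : enorm x <= `|x 0 0| + `|x 0 1|.
Proof.
rewrite -(@ler_pXn2r _ 2) ?nnegrE ?enorm_ge0 ?addr_ge0 // enorm2_sqr.
rewrite -(real_normK (num_real (x 0 0))) -(real_normK (num_real (x 0 1))).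
by have := mulr_ge0 (normr_ge0 (x 0 0)) (normr_ge0 (x 0 1)); nra.
Qed.

Lemma edistC (n : nat) (x y : 'rV[R]_n) : edist x y = edist y x.
Proof.
rewrite /edist /enorm; congr Num.sqrt; apply: eq_bigr => i _.
by rewrite !mxE; ring.
Qed.

(** [K] is a Lipschitz constant of the functional, so a gap between its values separates points. *)
Lemma functional_le_edist (c d e K : R) (x y : 'rV[R]_2) :
  `|c| + `|d| <= K ->
  e <= `|(c * x 0 0 + d * x 0 1) - (c * y 0 0 + d * y 0 1)| ->
  e / K <= edist x y.
Proof.
move=> cdK he.
(* Otherwise [K] is 0, and the quotient is 0 by convention. *)
have [K0|K0] := ltP 0 K; last first.
  have -> : K = 0 by apply/le_anti; rewrite K0 (le_trans _ cdK) // addr_ge0.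
  by rewrite invr0 mulr0 enorm_ge0.
have := norm0_le_enorm (x - y); have := norm1_le_enorm (x - y).
rewrite -/(edist x y) !mxE => h1 h0.
have E0 : 0 <= edist x y by exact: enorm_ge0.
have : `|(c * x 0 0 + d * x 0 1) - (c * y 0 0 + d * y 0 1)| <=
       `|c| * edist x y + `|d| * edist x y.
  rewrite (_ : _ - _ = c * (x 0 0 - y 0 0) + d * (x 0 1 - y 0 1)); last by ring.
  by rewrite (le_trans (ler_normD _ _)) // !normrM lerD ?ler_wpM2l.
rewrite -mulrDl => H; rewrite ler_pdivrMr // mulrC.
by rewrite (le_trans he) // (le_trans H) // ler_wpM2r.
Qed.

Lemma half_integer_gap (k l : int) : 1 / 2 <= `|(1 / 2 + k%:~R) - (l%:~R : R)|.
Proof.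
rewrite -addrA -intrB; set m := k - l; have [m0|m0] := leP 0 m.
  have : 0 <= m%:~R :> R by rewrite ler0z.
  by move=> h; rewrite ger0_norm; lra.
have : m%:~R <= (-1)%:~R :> R by rewrite ler_int; lia.
by rewrite intrN => h; rewrite ler0_norm; lra.
Qed.

(** By Cramer's rule the two functionals determine the point, so on distinct points one of them
    differs by a nonzero integer. *)
Lemma grid2_separated (a b c d s t K : R) (x y : 'rV[R]_2) :
  a * d - b * c != 0 -> `|a| + `|b| <= K -> `|c| + `|d| <= K ->
  grid2 a b c d s t x -> grid2 a b c d s t y -> x <> y -> 1 / K <= edist x y.
Proof.
move=> D0 ab cd [k [l [ek el]]] [k' [l' [ek' el']]] xy.
have gap (m n : int) (u : R) : m != n -> 1 <= `|(u + m%:~R) - (u + n%:~R)|.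
  move=> mn; rewrite opprD addrACA subrr add0r -intrB -intr_norm ler1z; lia.
have [kk|kk] := eqVneq k k'; last first.
  by apply: functional_le_edist ab _; rewrite ek ek' gap.
have [ll|ll] := eqVneq l l'; last first.
  by apply: functional_le_edist cd _; rewrite el el' gap.
case: xy; rewrite -kk -ek in ek'; rewrite -ll -el in el'.
have E0 (z : 'rV[R]_2) : (a * d - b * c) * z 0 0 =
    d * (a * z 0 0 + b * z 0 1) - b * (c * z 0 0 + d * z 0 1) by ring.
have E1 (z : 'rV[R]_2) : (a * d - b * c) * z 0 1 =
    a * (c * z 0 0 + d * z 0 1) - c * (a * z 0 0 + b * z 0 1) by ring.
by apply: row2P; apply: (mulfI D0); rewrite ?E0 ?E1 ek' el'.
Qed.

(** The witness is the grid point labelled [(k, l)]. Inverting the system divides by a determinant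
    of size at least 1, so the errors grow by at most the sum of the coefficients. *)
Lemma grid2_near (a b c d s t e K : R) (k l : int) (p : 'rV[R]_2) :
  1 <= `|a * d - b * c| -> `|a| + `|b| + `|c| + `|d| <= K ->
  `|a * p 0 0 + b * p 0 1 - s - k%:~R| <= e ->
  `|c * p 0 0 + d * p 0 1 - t - l%:~R| <= e ->
  exists2 y, grid2 a b c d s t y & edist p y <= K * e.
Proof.
set D := a * d - b * c => D1 abcd hk hl.
have e0 : 0 <= e by exact: le_trans hk.
have D0 : D != 0 by rewrite -normr_gt0 (lt_le_trans _ D1).
pose u := s + k%:~R; pose v := t + l%:~R.
pose y := row2 ((d * u - b * v) / D) ((a * v - c * u) / D).
exists y.
  exists k, l; rewrite !mxE /= -/u -/v /D; split; field; exact: D0.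
set h1 := _ - _ in hk; set h2 := _ - _ in hl.
apply: (le_trans (enorm2_le _)); rewrite !mxE /=.
have -> : p 0 0 - (d * u - b * v) / D = (d * h1 - b * h2) / D.
  by rewrite /h1 /h2 /u /v /D; field; exact: D0.
have -> : p 0 1 - (a * v - c * u) / D = (a * h2 - c * h1) / D.
  by rewrite /h1 /h2 /u /v /D; field; exact: D0.
have divD (z : R) : `|z / D| <= `|z|.
  by rewrite normrM normfV ler_piMr // invf_le1 // (lt_le_trans _ D1).
have := divD (d * h1 - b * h2); have := divD (a * h2 - c * h1).
have := ler_normB (d * h1) (b * h2); have := ler_normB (a * h2) (c * h1).
have := normM_le (lexx `|d|) hk; have := normM_le (lexx `|b|) hl.
have := normM_le (lexx `|a|) hl; have := normM_le (lexx `|c|) hk.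
have : (`|a| + `|b| + `|c| + `|d|) * e <= K * e by rewrite ler_wpM2r.
lra.
Qed.

(* The grids pairwise share one functional, on which their offsets differ by
   1/2; no functional is rational for all three. *)
Definition three_grids (i : 'I_3) : set 'rV[R]_2 :=
  match val i with
  | 0 => grid2 1 0 0 1 0 0
  | 1 => grid2 0 1 sqrt2 sqrt3 (1 / 2) 0
  | _ => grid2 1 0 sqrt2 sqrt3 (1 / 2) (1 / 2)
  end.

Lemma three_gridsP (x : 'rV[R]_2) : (\bigcup_i three_grids i) x <->
  [\/ grid2 1 0 0 1 0 0 x, grid2 0 1 sqrt2 sqrt3 (1 / 2) 0 x
    | grid2 1 0 sqrt2 sqrt3 (1 / 2) (1 / 2) x].
Proof.
split=> [[[[|[|[|//]]] lti] _]|[] h].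
- by constructor 1.
- by constructor 2.
- by constructor 3.
- by exists (@Ordinal 3 0 isT).
- by exists (@Ordinal 3 1 isT).
- by exists (@Ordinal 3 2 isT).
Qed.

Lemma normD_sqrt2_sqrt3_le : `|sqrt2| + `|sqrt3| <= 4.
Proof.
have := sqrt2_bounds R; have := sqrt3_bounds R.
by move=> /andP[? ?] /andP[? ?]; rewrite !ger0_norm; lra.
Qed.

Lemma three_grids_uniformly_discrete :
  uniformly_discrete (\bigcup_i three_grids i).
Proof.
(* Every functional involved has Lipschitz constant at most 5: different grids differ by 1/2 on a
   shared functional, and points of one grid by 1 on some functional. *)
exists (1 / 10); first by lra.
have s23 := normD_sqrt2_sqrt3_le.
have /andP[s2 _] := sqrt2_bounds R; have /andP[s3 _] := sqrt3_bounds R.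
have s25 : `|sqrt2| + `|sqrt3| <= 5 by lra.
have e10 : `|1 : R| + `|0 : R| <= 5 by rewrite normr1 normr0; lra.
have e01 : `|0 : R| + `|1 : R| <= 5 by rewrite normr1 normr0; lra.
have sep12 x y : grid2 1 0 0 1 0 0 x -> grid2 0 1 sqrt2 sqrt3 (1 / 2) 0 y ->
    1 / 10 <= edist y x.
  move=> [_ [l [_ el]]] [k [_ [ek _]]].
  rewrite (_ : 1 / 10 = 1 / 2 / 5); last by field.
  by apply: functional_le_edist e01 _; rewrite el ek add0r half_integer_gap.
have sep13 x y : grid2 1 0 0 1 0 0 x ->
    grid2 1 0 sqrt2 sqrt3 (1 / 2) (1 / 2) y -> 1 / 10 <= edist y x.
  move=> [l [_ [el _]]] [k [_ [ek _]]].
  rewrite (_ : 1 / 10 = 1 / 2 / 5); last by field.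
  by apply: functional_le_edist e10 _; rewrite el ek add0r half_integer_gap.
have sep23 x y : grid2 0 1 sqrt2 sqrt3 (1 / 2) 0 x ->
    grid2 1 0 sqrt2 sqrt3 (1 / 2) (1 / 2) y -> 1 / 10 <= edist y x.
  move=> [_ [l [_ el]]] [_ [k [_ ek]]].
  rewrite (_ : 1 / 10 = 1 / 2 / 5); last by field.
  by apply: functional_le_edist s25 _; rewrite el ek add0r half_integer_gap.
have le15 z : 1 / 5 <= z -> 1 / 10 <= z :> R by lra.
move=> x y /three_gridsP[] gx /three_gridsP[] gy xy.
- apply: le15; apply: grid2_separated gx gy xy => //.
- rewrite edistC; exact: sep12 gx gy.
- rewrite edistC; exact: sep13 gx gy.
- exact: sep12 gy gx.
- apply: le15; apply: grid2_separated gx gy xy => //.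
- rewrite edistC; exact: sep23 gx gy.
- exact: sep13 gy gx.
- exact: sep23 gy gx.
- apply: le15; apply: grid2_separated gx gy xy => //.
Qed.

Lemma three_grids_visibility (eps : R) : 0 < eps ->
  exists2 V : R, 0 < V & forall a b : 'rV[R]_2, edist a b = V ->
    exists2 p, segment a b p &
      exists2 y, (\bigcup_i three_grids i) y & edist p y <= eps.
Proof.
(* The 5 pays for the loss in [grid2_near], since the coefficients of each grid sum to at most 5 in
   absolute value. *)
move=> eps0; pose d := eps / 5; have d0 : 0 < d by rewrite divr_gt0.
have -> : eps = 5 * d by rewrite /d; field.
pose Q := Num.truncn d^-1.
have Qd : Q.+1%:R^-1 <= d.
  by rewrite invf_ple ?posrE ?ltr0n // ltW // truncnS_gt.
have [h h0 hh] := some_pair_has_no_small_relation R Q.+2.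
(* This is the time bound of [flow_meets_integers] with [C = 4], which dominates all three
   functionals on a unit vector. *)
pose V := (1 + Q.+1%:R * 4 / h) / h.
have V0 : 0 < V.
  by rewrite divr_gt0 // addr_gt0 // divr_gt0 // mulr_gt0 // ltr0n.
exists V => // a b; rewrite edistC => abV.
(* The unit direction of the segment: flow time is then arc length, and times up to [V] stay on the
   segment. *)
pose u i := (b - a) 0 i / V.
have nu i : `|u i| = `|(b - a) 0 i| / V.
  by rewrite normrM normfV (gtr0_norm V0).
have u0 : `|u 0| <= 1.
  by rewrite nu ler_pdivrMr // mul1r -abV norm0_le_enorm.
have u1 : `|u 1| <= 1.
  by rewrite nu ler_pdivrMr // mul1r -abV norm1_le_enorm.
have u01 : 1 <= `|u 0| + `|u 1|.
  by rewrite !nu -mulrDl ler_pdivlMr // mul1r -{1}abV enorm2_le.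
have s23 := normD_sqrt2_sqrt3_le.
have /andP[s2 _] := sqrt2_bounds R; have /andP[s3 _] := sqrt3_bounds R.
pose u2 := sqrt2 * u 0 + sqrt3 * u 1.
have u2le : `|u2| <= 4.
  apply: (le_trans (ler_normD _ _)).
  have := normM_le (lexx `|sqrt2|) u0; have := normM_le (lexx `|sqrt3|) u1.
  lra.
have u0' : `|u 0| <= 4 by lra.
have u1' : `|u 1| <= 4 by lra.
pose p (s : R) := a + (s / V) *: (b - a).
have pE s i : p s 0 i = a 0 i + s * u i by rewrite /p /u !mxE; field; rewrite gt_eqF.
have pS s : 0 <= s <= V -> segment a b (p s).
  move=> /andP[sl su]; exists (s / V) => //=; rewrite in_itv /= divr_ge0 // ?(ltW V0) //=.
  by rewrite ler_pdivrMr // mul1r.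
(* Each pair of functionals defines one of the grids; its offsets are subtracted from the starting
   point of the flow. *)
have [rel|rel|rel] := hh _ _ u01.
- have [s [k [l [sV hk hl]]]] :=
    flow_meets_integers (a 0 0) (a 0 1) h0 Qd u0' u1' rel.
  have [|||| y gy py] := @grid2_near 1 0 0 1 0 0 d 5 k l (p s).
  + by rewrite mulr1 mul0r subr0 normr1.
  + by rewrite normr1 normr0; lra.
  + by rewrite mul1r mul0r addr0 subr0 pE.
  + by rewrite mul1r mul0r add0r subr0 pE.
  exists (p s); first exact: pS.
  by exists y => //; apply/three_gridsP; constructor 1.
- have [s [k [l [sV hk hl]]]] := flow_meets_integers (a 0 1 - 1 / 2)
    (sqrt2 * a 0 0 + sqrt3 * a 0 1) h0 Qd u1' u2le rel.
  have [|||| y gy py] := @grid2_near 0 1 sqrt2 sqrt3 (1 / 2) 0 d 5 k l (p s).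
  + by rewrite mul1r mul0r sub0r normrN ger0_norm //; lra.
  + by rewrite normr1 normr0; lra.
  + by move: hk; rewrite !pE; congr (`|_| <= _); ring.
  + by move: hl; rewrite /u2 !pE; congr (`|_| <= _); ring.
  exists (p s); first exact: pS.
  by exists y => //; apply/three_gridsP; constructor 2.
- have [s [k [l [sV hk hl]]]] := flow_meets_integers (a 0 0 - 1 / 2)
    (sqrt2 * a 0 0 + sqrt3 * a 0 1 - 1 / 2) h0 Qd u0' u2le rel.
  have [|||| y gy py] := @grid2_near 1 0 sqrt2 sqrt3 (1 / 2) (1 / 2) d 5 k l (p s).
  + by rewrite mul1r mul0r subr0 ger0_norm //; lra.
  + by rewrite normr1 normr0; lra.
  + by move: hk; rewrite !pE; congr (`|_| <= _); ring.
  + by move: hl; rewrite /u2 !pE; congr (`|_| <= _); ring.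
  exists (p s); first exact: pS.
  by exists y => //; apply/three_gridsP; constructor 3.
Qed.

Lemma three_grids_dense_forest : dense_forest (\bigcup_i three_grids i).
Proof.
have /choice[v hv] : forall eps : R, exists V : R, 0 < eps -> 0 < V /\
    forall a b : 'rV[R]_2, edist a b = V -> exists2 p, segment a b p &
      exists2 y, (\bigcup_i three_grids i) y & edist p y <= eps.
  move=> eps; have [eps0|_] := ltP 0 eps; last by exists 0.
  by have [V V0 hV] := three_grids_visibility eps0; exists V.
by exists v => eps /hv[].
Qed.

Lemma three_grids_cut_and_project (i : 'I_3) : cut_and_project (three_grids i).
Proof.
have /andP[s2 _] := sqrt2_bounds R; have /andP[s3 _] := sqrt3_bounds R.
(* The determinants are 1, [- sqrt2] and [sqrt3]. *)
case: i => [[|[|i]] lti]; apply: cut_and_project_grid2.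
- by rewrite mulr1 mul0r subr0 oner_neq0.
- by rewrite mul0r mul1r sub0r oppr_eq0 gt_eqF //; lra.
- by rewrite mul0r mul1r subr0 gt_eqF //; lra.
Qed.

End ThreeGrids.

Theorem theorem1p2 (R : realType) :
  exists Y : set 'rV[R]_2,
    [/\ uniformly_discrete Y, dense_forest Y
      & finite_union_of_cut_and_project Y].
Proof.
exists (\bigcup_i @three_grids R i); split.
- exact: three_grids_uniformly_discrete.
- exact: three_grids_dense_forest.
- by exists 3, (@three_grids R); split=> // i; exact: three_grids_cut_and_project.
Qed.
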